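(* Let $\rho$ be a monotone risk measure on $\mathcal M$. For $\alpha\in(0,1]$, $\boldsymbol\theta=(\theta_1,\dots,\theta_n)\in(0,\infty)^n$ and $\Lambda\in\mathcal Q_n$, we have $\overline\rho(\mathbf P_{\alpha,\boldsymbol\theta})\le\overline\rho(\Lambda\mathbf P_{\alpha,\boldsymbol\theta})\le\overline\rho(\mathbf P_{\alpha,\Lambda\boldsymbol\theta})$.
   Context: Work on an atomless probability space. $\mathcal M$ is the set of cdfs on $\mathbb{R}$. A risk measure $\rho:\mathcal M\to\mathbb{R}$ is monotone if $\rho(F)\le\rho(G)$ whenever $F\ge G$ pointwise. $\overline\rho(\mathbf F)=\sup\{\rho(H):H\text{ is the cdf of }X_1+\dots+X_n,\ X_i\sim F_i\}$. $P_{\alpha,\theta}(x)=1-(\theta/x)^\alpha$ for $x\ge\theta$ (zero otherwise); $\mathbf P_{\alpha,\boldsymbol\theta}=(P_{\alpha,\theta_1},\dots,P_{\alpha,\theta_n})$. $\mathcal Q_n$ is the set of $n\times n$ doubly stochastic matrices; for $\Lambda=(\Lambda_{ij})\in\mathcal Q_n$, $\Lambda\mathbf F$ is the tuple with $i$-th component $\sum_j\Lambda_{ij}F_j$, and $\Lambda\boldsymbol\theta$ is the usual matrix-vector product. *)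

(* Defs.v *)
From HB Require Import structures.
From mathcomp Require Import all_boot all_order all_algebra.
From mathcomp Require Import all_classical all_reals all_analysis.
Set Implicit Arguments. Unset Strict Implicit. Unset Printing Implicit Defensive.
Import Order.TTheory GRing.Theory Num.Theory numFieldNormedType.Exports.
Local Open Scope classical_set_scope.
Local Open Scope ring_scope.

Definition atomless d (T : measurableType d) (R : realType) (P : probability T R) :=
  forall A : set T, measurable A -> (0 < P A)%E ->
    exists B : set T, [/\ measurable B, B `<=` A, (0 < P B)%E & (P B < P A)%E].

Definition is_cdf (R : realType) (F : R -> R) :=
  [/\ {homo F : x y / x <= y},
      (forall a : R, F x @[x --> a^'+] --> F a),
      F x @[x --> -oo] --> (0:R) &
      F x @[x --> +oo] --> (1:R)].

(* A risk measure rho : M -> R, modelled as a map on real functions of which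
   only the values on cdfs matter.  Monotone: rho F <= rho G when F >= G. *)
Definition monotone_rm (R : realType) (rho : (R -> R) -> R) :=
  forall F G : R -> R, is_cdf F -> is_cdf G ->
    (forall x, G x <= F x) -> rho F <= rho G.

Definition rv_cdf d (T : measurableType d) (R : realType) (P : probability T R)
  (X : T -> R) : R -> R := fun x => fine (P [set t | X t <= x]).

Definition rho_bar d (T : measurableType d) (R : realType) (P : probability T R)
  (rho : (R -> R) -> R) (n : nat) (F : 'I_n -> R -> R) : \bar R :=
  ereal_sup [set (rho H)%:E | H in
    [set H | exists X : 'I_n -> T -> R,
       [/\ forall i, measurable_fun setT (X i),
           forall i, rv_cdf P (X i) = F i &
           H = rv_cdf P (fun t => \sum_(i < n) X i t)]]].

Definition pareto (R : realType) (alpha theta : R) : R -> R :=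
  fun x => if theta <= x then 1 - (theta / x) `^ alpha else 0.

Definition pareto_tuple (R : realType) (n : nat) (alpha : R) (theta : 'I_n -> R)
  : 'I_n -> R -> R := fun i => pareto alpha (theta i).

Definition doubly_stochastic (R : realType) (n : nat) (L : 'M[R]_n) :=
  [/\ forall i j, 0 <= L i j,
      forall i, \sum_(j < n) L i j = 1 &
      forall j, \sum_(i < n) L i j = 1].

Definition mix_cdfs (R : realType) (n : nat) (L : 'M[R]_n) (F : 'I_n -> R -> R)
  : 'I_n -> R -> R := fun i x => \sum_(j < n) L i j * F j x.

Definition mix_vec (R : realType) (n : nat) (L : 'M[R]_n) (v : 'I_n -> R)
  : 'I_n -> R := fun i => \sum_(j < n) L i j * v j.

(* Main.v *)
(* First inequality: by Birkhoff, [L] is a convex combination of permutation matrices.  Given X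
   with marginals F, a vector distributed as the corresponding mixture of the permutations of X
   has marginals [mix_cdfs L F] and the same law of the sum.  The original X may generate the
   whole sigma-algebra, so no permutation independent of X need exist: the mixture is instead
   realized afresh, by coding vectors as bit streams and splitting the atomless space along the
   binary tree with Sierpinski's theorem.

   Second inequality: for [alpha <= 1] the map [theta |-> pareto alpha theta x] is convex, so
   [L P] is stochastically dominated componentwise by the Pareto laws with scales [L theta].
   Mixtures of Pareto laws have continuous cdfs, hence each X_i can be replaced by a pointwise
   larger deterministic function of itself having the dominating Pareto law. *)
Require Import Defs.
From HB Require Import structures.
From mathcomp Require Import all_boot all_order all_algebra all_fingroup.
From mathcomp Require Import all_classical all_reals all_analysis.
Set Implicit Arguments. Unset Strict Implicit. Unset Printing Implicit Defensive.
Import Order.TTheory GRing.Theory Num.Theory.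
Import numFieldNormedType.Exports.
From mathcomp Require Import measurable_realfun ring lra.
Local Open Scope ring_scope.

(** * Birkhoff's theorem on doubly stochastic matrices *)

(* If no row of [S] is a singleton then [#|S| >= 2n], whereas vanishing of all row and
   column sums amounts to at most [2n - 1] independent linear conditions. *)
Lemma sparse_row_or_flat_direction (R : fieldType) (n : nat) (S : {set 'I_n * 'I_n}) :
  (0 < n)%N -> (forall i, exists j, (i, j) \in S) ->
  (exists i j, forall j', ((i, j') \in S) = (j' == j)) \/
  exists D : 'M[R]_n,
    [/\ D != 0, forall i j, D i j != 0 -> (i, j) \in S,
        forall i, \sum_j D i j = 0 & forall j, \sum_i D i j = 0].
Proof.
move=> n_gt0 Sne.
have [/existsP[i /cards1P[j Sj]]|Hn] :=
    boolP [exists i, #|[set j | (i, j) \in S]| == 1%N].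
  left; exists i, j => j'.
  by move/setP: Sj => /(_ j'); rewrite !inE.
right.
have card2 i : (2 <= #|[set j | (i, j) \in S]|)%N.
  move: Hn; rewrite negb_exists => /forallP/(_ i).
  have [j Sj] := Sne i.
  have : (0 < #|[set j | (i, j) \in S]|)%N by apply/card_gt0P; exists j; rewrite inE.
  by case: #|_| => [|[|k]].
have cardS : (n + n <= #|S|)%N.
  have -> : #|S| = (\sum_(i < n) #|[set j | (i, j) \in S]|)%N.
    rewrite -sum1_card (eq_bigl (fun p => true && ((p.1, p.2) \in S))); last by case.
    rewrite -(pair_big_dep xpredT (fun i j => (i, j) \in S) (fun _ _ => 1%N)) /=.
    by apply: eq_bigr => i _; rewrite -sum1_card; apply: eq_bigl => j; rewrite inE.
  rewrite addnn -muln2 mulnC -{1}(card_ord n) mulnC -sum_nat_const.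
  by apply: leq_sum => i _.
case: n n_gt0 S Sne Hn card2 cardS => // n _ S Sne Hn card2 cardS.
pose e (k : 'I_#|S|) := enum_val k.
(* [K] sends coefficients on the entries of [S] to all row sums and all column sums but the last. It
   has fewer columns than rows, so a nonzero [v] lies in its left kernel; [D] spreads [v] over the
   matrix. *)
pose K : 'M[R]_(#|S|, n.+1 + n) := row_mx
  (\matrix_(k, i) ((e k).1 == i)%:R) (\matrix_(k, j) ((e k).2 == lift ord_max j)%:R).
have : kermx K != 0.
  rewrite -mxrank_eq0 mxrank_ker subn_eq0 -ltnNge.
  by apply: leq_ltn_trans (rank_leq_col _) _; apply: leq_trans cardS; rewrite addnS.
move/rowV0Pn => [v /sub_kermxP vK vn0].
pose D : 'M[R]_n.+1 := \matrix_(i, j) \sum_k v 0 k * (e k == (i, j))%:R.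
have De k : D (e k).1 (e k).2 = v 0 k.
  rewrite mxE (bigD1 k) //= -surjective_pairing eqxx mulr1 big1 ?addr0 // => k' k'k.
  by rewrite (inj_eq enum_val_inj) (negbTE k'k) mulr0.
have rowD i : \sum_j D i j = 0.
  have := congr1 (fun M : 'rV_(_ + _) => M 0 (lshift n i)) vK.
  rewrite mul_mx_row row_mxEl !mxE => K0; rewrite -[RHS]K0.
  under eq_bigr do rewrite mxE.
  rewrite exchange_big; apply: eq_bigr => k _; rewrite mxE -mulr_sumr; congr (_ * _).
  case: (e k) => a b /=; rewrite (bigD1 b) //= xpair_eqE eqxx andbT big1 ?addr0 // => j jb.
  by rewrite xpair_eqE [b == j]eq_sym (negbTE jb) andbF.
have colD j : j != ord_max -> \sum_i D i j = 0.
  rewrite eq_sym => /unlift_some[j' -> _].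
  have := congr1 (fun M : 'rV_(_ + _) => M 0 (rshift n.+1 j')) vK.
  rewrite mul_mx_row row_mxEr !mxE => K0; rewrite -[RHS]K0.
  under eq_bigr do rewrite mxE.
  rewrite exchange_big; apply: eq_bigr => k _; rewrite mxE -mulr_sumr; congr (_ * _).
  case: (e k) => a b /=; rewrite (bigD1 a) //= xpair_eqE eqxx andTb big1 ?addr0 // => i ia.
  by rewrite xpair_eqE [a == i]eq_sym (negbTE ia).
exists D; split => //.
- have [k vk] : exists k, v 0 k != 0 by apply/rV0Pn.
  apply: contraNneq vk => D0.
  by rewrite -De D0 mxE.
- move=> i j; apply: contraNT => ijS; rewrite mxE big1 // => k _.
  case: eqP => [ek|]; last by rewrite mulr0.
  by have := enum_valP k; rewrite -/(e k) ek (negbTE ijS).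
(* The omitted column sum vanishes because all entries together sum to zero and the other columns
   do. *)
- move=> j; have [->|/colD//] := eqVneq j ord_max.
  have : \sum_j \sum_i D i j = 0 by rewrite exchange_big big1.
  by rewrite (bigD1 ord_max) //= [X in _ + X]big1 ?addr0 // => i; apply: colD.
Qed.

Definition supp_mx (R : pzRingType) n (M : 'M[R]_n) :=
  [set p : 'I_n * 'I_n | M p.1 p.2 != 0].

(** Moving from [M] along [D] preserves row and column sums. The smallest ratio [r q] over the
    negative entries of [D] is the step at which a first entry reaches zero while none has become
    negative. *)
Lemma shrink_support (R : realFieldType) n (c : R) (M D : 'M[R]_n) :
  (forall i j, 0 <= M i j) -> (forall i, \sum_j M i j = c) -> (forall j, \sum_i M i j = c) ->
  D != 0 -> (forall i j, D i j != 0 -> (i, j) \in supp_mx M) ->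
  (forall i, \sum_j D i j = 0) -> (forall j, \sum_i D i j = 0) ->
  exists N : 'M[R]_n, [/\ (forall i j, 0 <= N i j), (forall i, \sum_j N i j = c),
    (forall j, \sum_i N i j = c) & supp_mx N \proper supp_mx M].
Proof.
move=> M0 Mr Mc Dn0 Dsub Dr Dc.
(* A nonnegative matrix with zero row sums would be zero. *)
have [p Dp] : exists p : 'I_n * 'I_n, D p.1 p.2 < 0.
  apply/existsP; apply: contraNT Dn0; rewrite negb_exists => /forallP Dge.
  apply/eqP/matrixP => i j; rewrite mxE.
  have D0 i' j' : 0 <= D i' j' by have := Dge (i', j'); rewrite -leNgt.
  apply/eqP; move/eqP: (Dr i); rewrite psumr_eq0 // => /allP/(_ j).
  by rewrite mem_index_enum => /(_ isT).
pose r (q : 'I_n * 'I_n) := M q.1 q.2 / - D q.1 q.2.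
case: (@arg_minP _ _ _ p (fun q => D q.1 q.2 < 0) r Dp) => q Dq qmin.
pose N := M + r q *: D.
have r0 : 0 <= r q by rewrite divr_ge0 // oppr_ge0 ltW.
exists N; split.
- move=> i j; rewrite !mxE; have [D0|D0] := leP 0 (D i j); first by rewrite addr_ge0 // mulr_ge0.
  have := qmin (i, j) D0; rewrite {2}/r /= ler_pdivlMr ?oppr_gt0 // mulrN.
  by rewrite -subr_ge0 opprK.
- by move=> i; under eq_bigr do rewrite !mxE; rewrite big_split /= -mulr_sumr Mr Dr mulr0 addr0.
- by move=> i; under eq_bigr do rewrite !mxE; rewrite big_split /= -mulr_sumr Mc Dc mulr0 addr0.
apply/properP; split.
  apply/fintype.subsetP => -[i j]; rewrite !inE /= !mxE; apply: contraNneq => Mij.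
  have := Dsub i j; rewrite inE /= Mij eqxx => Dij.
  by have [->|/Dij//] := eqVneq (D i j) 0; rewrite mulr0 addr0.
exists q; first by have := Dsub q.1 q.2; rewrite -surjective_pairing; apply; rewrite lt_eqF.
rewrite inE negbK !mxE /r invrN mulrN mulNr divfK ?subrr //.
by rewrite lt_eqF.
Qed.

(** Induction on the size, then on the support. A row with a single nonzero entry carries [c] there,
    which exhausts its column, so both can be deleted. Otherwise a flat direction shrinks the
    support, and a transversal of the smaller support also serves [M]. *)
Lemma positive_transversal (R : realFieldType) n (c : R) (M : 'M[R]_n) :
  0 < c -> (forall i j, 0 <= M i j) ->
  (forall i, \sum_j M i j = c) -> (forall j, \sum_i M i j = c) ->
  exists s : 'S_n, forall i, 0 < M i (s i).
Proof.
move=> c0; elim: n M => [|n IHn] M; first by move=> _ _ _; exists 1%g => -[].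
have [k] := ubnP #|supp_mx M|; elim: k M => // k IHk M kM M0 Mr Mc.
have rowne i : exists j, (i, j) \in supp_mx M.
  apply/existsP; apply: contraTT c0; rewrite negb_exists => /forallP Mi.
  rewrite -leNgt -(Mr i) big1 // => j _.
  by have := Mi j; rewrite inE negbK => /eqP.
have [[i [j ij]]|[D [Dn0 Dsub Dr Dc]]] := sparse_row_or_flat_direction R (ltn0Sn n) rowne.
- have Mi j' : j' != j -> M i j' = 0.
    by rewrite -ij inE negbK => /eqP.
  have Mij : M i j = c by rewrite -(Mr i) (bigD1 j) //= big1 ?addr0.
  have Mj i' : i' != i -> M i' j = 0.
    have /eqP := Mc j; rewrite (bigD1 i) //= Mij -subr_eq0 addrAC subrr add0r.
    by rewrite psumr_eq0 // => /allP H ii; apply/eqP; apply: (implyP (H i' (mem_index_enum i'))).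
  have [|i'|j'|s sP] := IHn (row' i (col' j M)).
  + by move=> i' j'; rewrite !mxE.
  + under eq_bigr do rewrite !mxE.
    rewrite -(Mr (lift i i')) (bigD1_ord j) //= Mj ?add0r //; by rewrite eq_sym neq_lift.
  + under eq_bigr do rewrite !mxE.
    rewrite -(Mc (lift j j')) (bigD1_ord i) //= Mi ?add0r //; by rewrite eq_sym neq_lift.
  exists (lift_perm i j s) => i'; have [->|] := eqVneq i' i; first by rewrite lift_perm_id Mij.
  rewrite eq_sym => /unlift_some[i'' -> _]; rewrite lift_perm_lift.
  by have := sP i''; rewrite !mxE.
- have [N [N0 Nr Nc NM]] := shrink_support M0 Mr Mc Dn0 Dsub Dr Dc.
  have [|s sP] := IHk N _ N0 Nr Nc.
    by apply: leq_trans (proper_card NM) _; rewrite -ltnS.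
  exists s => i; rewrite lt0r M0 andbT.
  have /fintype.subsetP/(_ (i, s i)) := proper_sub NM; rewrite !inE; apply.
  by rewrite gt_eqF.
Qed.

(** The common line sum [c] is arbitrary so that the induction on the support applies to remainders:
    removing [t] times a permutation matrix, with [t] the least entry of [M] along a transversal,
    leaves line sums [c - t] and kills an entry. *)
Lemma birkhoff (R : realFieldType) n (c : R) (M : 'M[R]_n) :
  (forall i j, 0 <= M i j) ->
  (forall i, \sum_j M i j = c) -> (forall j, \sum_i M i j = c) -> (0 < n)%N ->
  exists w : 'S_n -> R, [/\ forall s, 0 <= w s, \sum_s w s = c &
    forall i j, M i j = \sum_s w s * (s i == j)%:R].
Proof.
have [k] := ubnP #|supp_mx M|; elim: k c M => // k IHk c M kM M0 Mr Mc n0.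
pose i0 := Ordinal n0.
have c0 : 0 <= c by rewrite -(Mr i0) sumr_ge0.
have [cE|cn0] := eqVneq c 0.
  exists (fun _ => 0); split => //; first by rewrite big1.
  move=> i j; rewrite big1; last by move=> s _; rewrite mul0r.
  by move: (Mr i) => /eqP; rewrite cE psumr_eq0 // => /allP/(_ j (mem_index_enum j))/eqP.
have c_gt0 : 0 < c by rewrite lt0r cn0.
have [s sP] := positive_transversal c_gt0 M0 Mr Mc.
case: (@arg_minP _ _ _ i0 xpredT (fun i => M i (s i)) isT) => i1 _ imin.
pose t := M i1 (s i1).
pose N : 'M[R]_n := \matrix_(i, j) (M i j - t * (s i == j)%:R).
have [| | | | |w [w0 wc wN]] := IHk (c - t) N.
- apply: leq_trans (_ : #|supp_mx M| <= k)%N; last by rewrite -ltnS.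
  apply: proper_card; apply/properP; split.
    apply/fintype.subsetP => -[i j]; rewrite !inE /= mxE; apply: contraNneq => Mij.
    case: (s i =P j) => [sij|_]; last by rewrite Mij mulr0 subr0.
    by have := sP i; rewrite sij Mij ltxx.
  exists (i1, s i1); first by rewrite inE /= gt_eqF.
  by rewrite inE negbK mxE eqxx mulr1 subrr.
- move=> i j; rewrite mxE subr_ge0; case: eqP => [<-|_]; last by rewrite mulr0.
  by rewrite mulr1 imin.
- move=> i; under eq_bigr do rewrite mxE.
  rewrite sumrB Mr -mulr_sumr; congr (_ - _).
  rewrite (bigD1 (s i)) //= eqxx big1 ?addr0 ?mulr1 // => j jb.
  by rewrite eq_sym (negbTE jb).
- move=> j; under eq_bigr do rewrite mxE.
  rewrite sumrB Mc -mulr_sumr; congr (_ - _).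
  rewrite (bigD1 ((s^-1)%g j)) //= permKV eqxx big1 ?addr0 ?mulr1 // => i.
  by rewrite -(inj_eq (@perm_inj _ s)) permKV => /negbTE ->.
- exact: n0.
exists (fun s' => w s' + t * (s' == s)%:R); split.
- by move=> s'; rewrite addr_ge0 ?w0 ?mulr_ge0 ?ler0n ?ltW ?sP.
- rewrite big_split /= wc -mulr_sumr (bigD1 s) //= eqxx.
  by rewrite big1 ?addr0 ?mulr1 ?subrK // => s' /negbTE ->.
- move=> i j; under eq_bigr do rewrite mulrDl.
  rewrite big_split /= -wN mxE.
  rewrite [X in _ = _ + X](bigD1 s) //= eqxx mulr1 [X in _ = _ + (_ + X)]big1 ?addr0 ?subrK //.
  by move=> s' /negbTE ->; rewrite mulr0 mul0r.
Qed.

Local Open Scope classical_set_scope.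

(** * Sierpinski's theorem on atomless spaces *)

Lemma fine_probabilityK d (T : measurableType d) (R : realType)
  (P : probability T R) (A : set T) : measurable A -> (fine (P A))%:E = P A.
Proof. by move=> mA; rewrite fineK // fin_num_measure. Qed.

Lemma fine_probabilityD d (T : measurableType d) (R : realType)
  (P : probability T R) (A B : set T) : measurable A -> measurable B -> B `<=` A ->
  fine (P (A `\` B)) = fine (P A) - fine (P B).
Proof.
move=> mA mB BA; have mAB := measurableD mA mB.
apply: EFin_inj; rewrite EFinB !fine_probabilityK // measureD //; last first.
  by rewrite ltey_eq fin_num_measure.
by rewrite setIidr.
Qed.

Lemma fine_probability_le d (T : measurableType d) (R : realType)
  (P : probability T R) (A B : set T) : measurable A -> measurable B -> A `<=` B ->
  fine (P A) <= fine (P B).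
Proof. by move=> mA mB AB; rewrite fine_le ?fin_num_measure // le_measure ?inE. Qed.

(** Of a proper piece of [A] and its complement in [A], one has at most half the mass. *)
Lemma atomless_halving d (T : measurableType d) (R : realType) (P : probability T R)
  (A : set T) : atomless P -> measurable A -> 0 < fine (P A) ->
  exists B, [/\ measurable B, B `<=` A, 0 < fine (P B) & fine (P B) <= fine (P A) / 2].
Proof.
move=> aP mA A0.
have [|B [mB BA B0 PBA]] := aP A mA; first by rewrite -fine_probabilityK // lte_fin.
rewrite -fine_probabilityK // lte_fin in B0.
rewrite -(fine_probabilityK P mA) -(fine_probabilityK P mB) lte_fin in PBA.
have [h|h] := leP (fine (P B)) (fine (P A) / 2); first by exists B.
exists (A `\` B); split; [exact: measurableD|by apply: subDsetl| |].
  by rewrite fine_probabilityD // subr_gt0.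
by rewrite fine_probabilityD //; lra.
Qed.

Lemma atomless_small_subset d (T : measurableType d) (R : realType) (P : probability T R)
  (A : set T) (e : R) : atomless P -> measurable A -> 0 < fine (P A) -> 0 < e ->
  exists B, [/\ measurable B, B `<=` A, 0 < fine (P B) & fine (P B) < e].
Proof.
move=> aP mA A0 e0.
(* This many halvings suffice because 2 ^ k exceeds k. *)
have [B [mB BA B0 Be]] : exists B, [/\ measurable B, B `<=` A, 0 < fine (P B) &
    fine (P B) <= fine (P A) / 2 ^+ Num.bound (fine (P A) / e)].
  elim: (Num.bound _) => [|n [B [mB BA B0 Bn]]].
    by exists A; split => //; rewrite expr0 divr1.
  have [C [mC CB C0 CBn]] := atomless_halving aP mB B0.
  exists C; split => //; first exact: subset_trans CB BA.
  apply: le_trans CBn _; rewrite exprS invfM mulrA mulrAC.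
  by rewrite ler_wpM2r // invr_ge0.
exists B; split => //; apply: le_lt_trans Be _.
rewrite ltr_pdivrMr ?exprn_gt0 // mulrC -ltr_pdivrMr //.
apply: lt_le_trans (_ : (Num.bound (fine (P A) / e))%:R <= _).
  by apply: archi_boundP; rewrite divr_ge0 // ltW.
by rewrite -natrX ler_nat ltnW // ltn_expl.
Qed.

(** [C] is chosen to reach at least half the supremum of the admissible masses; the supremum itself
    need not be attained. *)
Lemma greedy_subset d (T : measurableType d) (R : realType) (P : probability T R)
  (A : set T) (c : R) : 0 <= c ->
  exists C, [/\ measurable C, C `<=` A, fine (P C) <= c &
    forall D, measurable D -> D `<=` A -> fine (P D) <= c -> fine (P D) <= 2 * fine (P C)].
Proof.
move=> c0.
pose S := [set fine (P D) | D in [set D | [/\ measurable D, D `<=` A & fine (P D) <= c]]].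
have S0 : S 0.
  by exists set0; [split => //|]; rewrite measure0.
have supS : has_sup S by split; [exists 0|exists c => _ [D [_ _ Dc] <-]].
have [s0|s0] := leP (sup S) 0.
  exists set0; split => //; rewrite measure0 //= => D mD DA Dc.
  rewrite mulr0; apply: le_trans s0; apply: ub_le_sup; first by case: supS.
  by exists D.
have [|_ [C [mC CA Cc] <-] sC] := @sup_adherent _ S (sup S / 2) _ supS; first by rewrite divr_gt0.
exists C; split => // D mD DA Dc; apply: le_trans (_ : sup S <= _); last by lra.
by apply: ub_le_sup; [case: supS|exists D].
Qed.

(** Exhaustion: near-maximal pieces are added as long as the total stays at most [c]. If the union
    fell short of [c], a small piece left over would have been admissible in every round, forcing
    unbounded growth. *)
Lemma sierpinski d (T : measurableType d) (R : realType) (P : probability T R)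
  (A : set T) (c : R) : atomless P -> measurable A -> 0 <= c -> c <= fine (P A) ->
  exists B, [/\ measurable B, B `<=` A & fine (P B) = c].
Proof.
move=> aP mA c0 cA.
pose ok B := [/\ measurable B, B `<=` A & fine (P B) <= c].
(* The condition [ok B] sits under the existential so that choice yields a total function, with the
   default [set0]. *)
have step B : exists C, ok B -> [/\ measurable C, C `<=` A `\` B,
    fine (P C) <= c - fine (P B) & forall D, measurable D -> D `<=` A `\` B ->
    fine (P D) <= c - fine (P B) -> fine (P D) <= 2 * fine (P C)].
  have [okB|nokB] := pselect (ok B); last by exists set0.
  have [|C Cp] := @greedy_subset _ T R P (A `\` B) (c - fine (P B)); last by exists C.
  by rewrite subr_ge0; case: okB.
have [f fP] := choice step.
pose B n := iter n (fun B => B `|` f B) set0.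
have PU n : ok (B n) -> fine (P (B n.+1)) = fine (P (B n)) + fine (P (f (B n))).
  move=> okB; have [mB BA Bc] := okB; have [mC CA Cc _] := fP _ okB.
  rewrite /= measureU ?fineD ?fin_num_measure // -subset0 => t [Bt /CA[]] //.
have okB n : ok (B n).
  elim: n => [|n IH]; first by split; rewrite ?/B /= ?measure0.
  have := PU n IH; have [mB BA Bc] := IH; have [mC CA Cc _] := fP _ IH => E.
  split; [exact: measurableU| |by rewrite E; lra].
  by move=> t [/BA//|/CA[]].
have mB n : measurable (B n) by case: (okB n).
have mU : measurable (\bigcup_n B n) by exact: bigcup_measurable.
have ndB : nondecreasing_seq B.
  by apply/nondecreasing_seqP => n; apply/subsetPset => t; left.
have UA : \bigcup_n B n `<=` A by move=> t [n _]; case: (okB n) => _ + _; apply.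
have Uc : fine (P (\bigcup_n B n)) <= c.
  rewrite -lee_fin fine_probabilityK //.
  have cv := nondecreasing_cvg_mu (mu := P) mB mU ndB.
  rewrite -(cvg_lim _ cv) //; apply: lime_le; first by apply/cvg_ex; eexists; exact: cv.
  by apply: nearW => n /=; rewrite -fine_probabilityK // lee_fin; case: (okB n).
exists (\bigcup_n B n); split => //; apply/eqP; rewrite eq_le Uc leNgt; apply/negP => Ult.
have [|||D [mD DU D0 Dlt]] := @atomless_small_subset _ T R P (A `\` \bigcup_n B n)
    (c - fine (P (\bigcup_n B n))) aP; [exact: measurableD| |by rewrite subr_gt0|].
  by rewrite fine_probabilityD // subr_gt0 (lt_le_trans Ult).
(* [D] avoids the union and fits the remaining budget of each round, so each round gains at least
   half its mass. *)
have grow n : n%:R * (fine (P D) / 2) <= fine (P (B n)).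
  elim: n => [|n IH]; first by rewrite mul0r fine_ge0.
  rewrite PU // -natr1 mulrDl mul1r lerD //.
  have [_ _ _ /(_ D mD)] := fP _ (okB n); rewrite ler_pdivrMr // mulrC; apply.
    by move=> t /DU[At nU]; split => // Bt; apply: nU; exists n.
  apply: le_trans (ltW Dlt) _; rewrite lerB //; apply: fine_probability_le => //.
  by move=> t; exists n.
have := grow (Num.bound (c / (fine (P D) / 2))); apply/negP; rewrite -ltNge.
apply: le_lt_trans (_ : c < _); first by case: (okB (Num.bound (c / (fine (P D) / 2)))).
rewrite -ltr_pdivrMr ?divr_gt0 //; apply: archi_boundP.
by rewrite divr_ge0 // divr_ge0 // ltW.
Qed.

(** * Distribution functions of random variables *)

Lemma measurable_sublevel d (T : measurableType d) (R : realType) (X : T -> R) (x : R) :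
  measurable_fun setT X -> measurable [set t | X t <= x].
Proof.
move=> mX; have := mX measurableT _ (measurable_itv `]-oo, x]%R).
by rewrite setTI set_itvNyc.
Qed.

Lemma rv_cdf_is_cdf d (T : measurableType d) (R : realType) (P : probability T R)
  (X : T -> R) : measurable_fun setT X -> is_cdf (rv_cdf P X).
Proof.
move=> mX.
pose X' : {RV P >-> R} := mfun_Sub (mem_set mX).
have E x : cdf X' x = (rv_cdf P X x)%:E.
  rewrite /rv_cdf fineK; last by rewrite fin_num_measure //; exact: measurable_sublevel.
  by rewrite /cdf /distribution /= /pushforward set_itvNyc.
have E' : rv_cdf P X = fine \o cdf X' by apply/funext => x /=; rewrite E.
split.
- by move=> x y xy; rewrite -lee_fin -!E cdf_nondecreasing.
- move=> a; rewrite E'; apply: fine_cvg; rewrite /= E /=.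
  by have := @cdf_right_continuous _ _ _ _ X' a; rewrite E.
- by rewrite E'; apply: fine_cvg; exact: cvg_cdfNy0.
- by rewrite E'; apply: fine_cvg; exact: cvg_cdfy1.
Qed.

Lemma rv_cdf_le d (T : measurableType d) (R : realType) (P : probability T R)
  (X Y : T -> R) : measurable_fun setT X -> measurable_fun setT Y ->
  (forall t, X t <= Y t) -> forall x, rv_cdf P Y x <= rv_cdf P X x.
Proof.
move=> mX mY XY x; have mXx := measurable_sublevel x mX; have mYx := measurable_sublevel x mY.
rewrite /rv_cdf fine_le ?fin_num_measure ?le_measure ?inE //.
by move=> t /=; apply: le_trans.
Qed.

(** * Concavity of powers, and Pareto cdfs as functions of the scale *)

(** Young's inequality with exponents [a^-1] and [(1 - a)^-1], applied to the [a]-th power of [t]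
    and to [1]. For [a = 1] the second exponent degenerates. *)
Lemma powR_tangent (R : realType) (a t : R) : 0 < a <= 1 -> 0 <= t -> t `^ a <= 1 + a * (t - 1).
Proof.
move=> /andP[a0 a1] t0; have [->|an1] := eqVneq a 1; first by rewrite powRr1 // mul1r addrC subrK.
have b0 : 0 < 1 - a by rewrite subr_gt0 lt_neqAle an1.
have := @conjugate_powR R (t `^ a) 1 a^-1 (1 - a)^-1 (powR_ge0 _ _) ler01.
rewrite !invr_gt0 !invrK => /(_ a0 b0 (subrKC _ _)).
by rewrite mulr1 -powRrM divff ?gt_eqF // powRr1 // powR1 mul1r => /le_trans; apply; lra.
Qed.

(** Jensen's inequality: the tangent bound is used at each [x i / m], and the linear terms average
    to zero. *)
Lemma concave_powR (R : realType) (n : nat) (a : R) (l x : 'I_n -> R) : 0 < a <= 1 ->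
  (forall i, 0 <= l i) -> \sum_i l i = 1 -> (forall i, 0 <= x i) -> 0 < \sum_i l i * x i ->
  \sum_i l i * x i `^ a <= (\sum_i l i * x i) `^ a.
Proof.
move=> a01 l0 l1 x0; set m := \sum_i _ * _ => m0.
apply: (@le_trans _ _ (\sum_i l i * (m `^ a * (1 + a * (x i / m - 1))))).
  apply: ler_sum => i _; apply: ler_wpM2l => //.
  have -> : x i `^ a = m `^ a * (x i / m) `^ a.
    have m0' := ltW m0.
    by rewrite -powRM ?divr_ge0 // mulrC divfK ?gt_eqF.
  by apply: ler_wpM2l; [exact: powR_ge0|apply: powR_tangent => //; rewrite divr_ge0 // ltW].
rewrite (eq_bigr (fun i => m `^ a * (1 - a) * l i + m `^ a * a / m * (l i * x i))); last first.
  by move=> i _; ring.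
rewrite big_split /= -!mulr_sumr l1 -/m divfK ?gt_eqF //; lra.
Qed.

Lemma powR_le1 (R : realType) (a t : R) : 0 <= a -> 0 <= t <= 1 -> t `^ a <= 1.
Proof.
move=> a0 /andP[t0 t1].
by apply: le_trans (ge0_ler_powR a0 _ _ t1) _; rewrite ?nnegrE // powR1.
Qed.

Lemma powR_ge1 (R : realType) (a t : R) : 0 <= a -> 1 <= t -> 1 <= t `^ a.
Proof.
move=> a0 t1; have := @ge0_ler_powR R a a0 1 t; rewrite powR1; apply; rewrite ?nnegrE //.
exact: le_trans t1.
Qed.

(** Merging both cases into one formula makes bounds, monotonicity and continuity follow by
    composition. *)
Lemma pareto_maxE (R : realType) (a th x : R) : 0 < th ->
  pareto a th x = 1 - (th / Num.max th x) `^ a.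
Proof.
move=> th0; rewrite /pareto; case: leP => // xth.
by rewrite divff ?gt_eqF // powR1 subrr.
Qed.

Lemma pareto_ge0 (R : realType) (a th x : R) : 0 < th -> 0 < a -> 0 <= pareto a th x.
Proof.
move=> th0 a0; rewrite pareto_maxE // subr_ge0.
have m0 : 0 < Num.max th x by rewrite lt_max th0.
by rewrite powR_le1 ?(ltW a0) // ltW ?divr_gt0 //= ler_pdivrMr // mul1r le_max lexx.
Qed.

Lemma pareto_lt1 (R : realType) (a th x : R) : 0 < th -> pareto a th x < 1.
Proof.
move=> th0; rewrite pareto_maxE // ltrBlDr ltrDl powR_gt0 // divr_gt0 // lt_max th0 //.
Qed.

Lemma pareto_nondecreasing (R : realType) (a th : R) : 0 < th -> 0 < a ->
  {homo pareto a th : x y / x <= y}.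
Proof.
move=> th0 a0 x y xy; rewrite !pareto_maxE // lerB //.
have m0 z : 0 < Num.max th z by rewrite lt_max th0.
apply: ge0_ler_powR; rewrite ?nnegrE ?divr_ge0 ?(ltW a0) ?(ltW th0) ?(ltW (m0 _)) //.
by rewrite ler_pM2l // lef_pV2 ?posrE // ge_max !le_max lexx xy /= orbT.
Qed.

Lemma pareto_continuous (R : realType) (a th : R) : 0 < th -> continuous (pareto a th).
Proof.
move=> th0.
have -> : pareto a th = fun x => 1 - (th / Num.max th x) `^ a.
  by apply/funext => x; rewrite pareto_maxE.
move=> x; have m0 : 0 < Num.max th x by rewrite lt_max th0.
apply: cvgB; first exact: cvg_cst.
apply: (@continuous_comp _ _ _ (fun x => th / Num.max th x) (fun y => y `^ a)).
  apply: cvgM; first exact: cvg_cst.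
  apply: cvgV; first by rewrite gt_eqF.
  by apply: continuous_max; [exact: cvg_cst|exact: cvg_id].
apply: differentiable_continuous; apply/derivable1_diffP; apply: derivable_powR.
by rewrite in_itv /= andbT divr_gt0.
Qed.

(** Below the mean scale the left side is [0]. Above it, the power formula is a lower bound for
    every component, being nonpositive where [x < th i], so concavity applies to all terms at
    once. *)
Lemma pareto_mix_ge (R : realType) (n : nat) (a x : R) (l th : 'I_n -> R) : 0 < a <= 1 ->
  (forall i, 0 <= l i) -> \sum_i l i = 1 -> (forall i, 0 < th i) ->
  pareto a (\sum_i l i * th i) x <= \sum_i l i * pareto a (th i) x.
Proof.
move=> a01 l0 l1 th0; have /andP[a0 _] := a01.
set m := \sum_i l i * th i.
have p0 i : 0 <= l i * pareto a (th i) x by rewrite mulr_ge0 // pareto_ge0.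
rewrite {1}/pareto; case: ifP => [mx|_]; last by rewrite sumr_ge0.
have m0 : 0 < m.
  rewrite lt_neqAle sumr_ge0 ?andbT; last by move=> i _; rewrite mulr_ge0 // ltW.
  apply/eqP => /esym/eqP; rewrite psumr_eq0; last by move=> i _; rewrite mulr_ge0 // ltW.
  move=> /allP H; have : \sum_i l i = 0.
    apply: big1 => i _; have := H i (mem_index_enum i); rewrite mulf_eq0 (gt_eqF (th0 i)) orbF.
    by move/eqP.
  by rewrite l1 => /eqP; rewrite oner_eq0.
have x0 : 0 < x by exact: lt_le_trans m0 mx.
apply: (@le_trans _ _ (\sum_i (l i - l i * (th i / x) `^ a))).
  have E : m / x = \sum_i l i * (th i / x).
    by rewrite mulr_suml; apply: eq_bigr => i _; rewrite mulrA.
  rewrite sumrB l1 lerB // E; apply: concave_powR => // [i|]; last by rewrite -E divr_gt0.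
  by rewrite divr_ge0 // ltW.
apply: ler_sum => i _; rewrite -{1}[l i]mulr1 -mulrBr ler_wpM2l //.
rewrite /pareto; have [//|thx] := leP (th i) x; rewrite subr_le0 powR_ge1 ?(ltW a0) //.
by rewrite ler_pdivlMr // mul1r ltW.
Qed.

(** * Raising a variable to a dominating Pareto law *)

(** [y] is the supremum of the sublevel set of [u], which is bounded as [G] tends to [1] and closed
    by continuity. The intermediate value theorem shows that the level is attained. *)
Lemma level_of_continuous_cdf (R : realType) (G : R -> R) (u : R) : is_cdf G ->
  continuous G -> u < 1 -> (exists y, G y <= u) -> 0 <= u ->
  exists y, G y = u /\ forall z, (G z <= u) = (z <= y).
Proof.
move=> [Gm _ _ G1] Gc u1 [y0 Gy0] u0.
have [M [Mr HM]] : \forall x \near +oo, u < G x.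
  exact: (cvgr_gt 1 G1).
pose S := [set y | G y <= u].
have ubS : ubound S M.
  by move=> y /= Sy; rewrite leNgt; apply/negP => /HM; rewrite ltNge Sy.
have supS : has_sup S by split; [exists y0|exists M].
have Ssup : S (sup S).
  have cS : closed S.
    have -> : S = G @^-1` [set x | x <= u] by [].
    by apply: preimage_closed => [x _|]; [exact: Gc|exact: closed_le].
  by apply: cS; apply: closure_sup; case: supS.
have [c _ Gcu] : exists2 c, c \in `[y0, M + 1]%R & G c = u.
  have y0M : y0 <= M + 1 by rewrite (le_trans (ubS _ Gy0)) // lerDl.
  apply: IVT => //; first by apply: continuous_subspaceT.
  have GM : u < G (M + 1) by apply: HM; rewrite ltrDl.
  by rewrite ge_min Gy0 /= le_max (ltW GM) orbT.
exists (sup S).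
have Gs : G (sup S) = u.
  apply/eqP; rewrite eq_le Ssup /= -Gcu; apply: Gm; apply: ub_le_sup; first by case: supS.
  by rewrite /S /= Gcu.
split => // z; apply/idP/idP => [Gz|zy]; last by rewrite -Gs; exact: Gm.
by apply: ub_le_sup; first by case: supS.
Qed.

(** A probability integral transform: [Y] passes through its own cdf and then the Pareto quantile
    function. Continuity of the cdf makes the resulting law exact, and the cdf bound makes the map
    increase values. *)
Lemma pareto_rearrangement d (T : measurableType d) (R : realType) (P : probability T R)
  (a th : R) (Y : T -> R) : 0 < a -> 0 < th -> measurable_fun setT Y ->
  continuous (rv_cdf P Y) -> (forall y, pareto a th y <= rv_cdf P Y y < 1) ->
  (exists y, rv_cdf P Y y = 0) ->
  exists Z, [/\ measurable_fun setT Z, rv_cdf P Z = pareto a th & forall t, Y t <= Z t].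
Proof.
move=> a0 th0 mY Gc Gth [y0 Gy0].
have Gcdf := rv_cdf_is_cdf P mY.
set G := rv_cdf P Y in Gc Gth Gy0 Gcdf *.
have [Gm _ _ _] := Gcdf.
have G1 y : G y < 1 by case/andP: (Gth y).
(* [h] is the quantile function of [pareto a th] composed with [G]. *)
pose h y := th / (1 - G y) `^ a^-1.
have c0 y : 0 < 1 - G y by rewrite subr_gt0.
have hm : {homo h : x y / x <= y}.
  move=> x y xy; rewrite /h ler_pM2l // lef_pV2 ?posrE ?powR_gt0 //.
  by rewrite ge0_ler_powR ?nnegrE ?invr_ge0 ?(ltW a0) ?(ltW (c0 _)) // lerB // Gm.
(* The adjunction between quantile function and cdf. The conjunct [th <= x] excludes points below
   [th], where the Pareto cdf is [0] and could still equal [G y]. *)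
have hle x y : (h y <= x) = (th <= x) && (G y <= pareto a th x).
  have hth : th <= h y.
    rewrite /h ler_pdivlMr ?powR_gt0 // ger_pMr //.
    have G0 : 0 <= G y by rewrite fine_ge0.
    by rewrite powR_le1 ?invr_ge0 ?(ltW a0) // (ltW (c0 y)) /= gerBl.
  have [thx|xth] := leP th x; last by apply/negbTE; rewrite -ltNge (lt_le_trans xth).
  have x0 : 0 < x by exact: lt_le_trans thx.
  rewrite /pareto thx /= [RHS]lerBrDr [X in _ = (X <= _)]addrC -[RHS]lerBrDr.
  rewrite /h ler_pdivrMr ?powR_gt0 // mulrC -ler_pdivrMr //.
  apply/idP/idP => H.
    have := ge0_ler_powR (ltW a0) _ _ H; rewrite -powRrM mulVf ?gt_eqF // powRr1; last exact: ltW.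
    by apply; rewrite nnegrE ?powR_ge0 // divr_ge0 // ltW.
  have := @ge0_ler_powR R a^-1 _ _ _ _ _ H; rewrite -powRrM divff ?gt_eqF //.
  rewrite powRr1; last by rewrite divr_ge0 // ltW.
  by apply; rewrite ?nnegrE ?powR_ge0 ?invr_ge0 // ltW.
exists (h \o Y); split.
- apply: measurableT_comp mY; exact: nondecreasing_measurable.
- apply/funext => x; rewrite {1}/rv_cdf /=.
  under eq_set do rewrite hle.
  have [thx|xth] := leP th x; last first.
    by rewrite /pareto leNgt xth /= (_ : [set _ | _] = set0) ?measure0 // -subset0 => t.
  (* The event becomes a half-line event for [Y], ending at a point where [G] takes exactly the
     Pareto value. *)
  have [||y [Gy Gyle]] := @level_of_continuous_cdf R G (pareto a th x) Gcdf Gc (pareto_lt1 a x th0).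
  + by exists y0; rewrite Gy0 pareto_ge0.
  + exact: pareto_ge0.
  rewrite -[RHS]Gy {2}/G /rv_cdf; congr (fine (P _)); apply/seteqP; split => t /=; rewrite Gyle //.
- move=> t /=; have [y0'|y0'] := leP (Y t) th.
    by apply: (le_trans y0'); have := hle (h (Y t)) (Y t); rewrite lexx => /esym/andP[].
  have Yt0 := lt_trans th0 y0'.
  case/andP: (Gth (Y t)); rewrite {1}/pareto (ltW y0') lerBlDr addrC -lerBlDr => H _.
  rewrite /h /= ler_pdivlMr ?powR_gt0 // mulrC -ler_pdivlMr //.
  have := @ge0_ler_powR R a^-1 _ _ _ _ _ H; rewrite -powRrM divff ?gt_eqF //.
  rewrite powRr1; last by rewrite divr_ge0 // ltW.
  by apply; rewrite ?nnegrE ?powR_ge0 ?invr_ge0 // ltW.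
Qed.

(** * The second inequality *)

(** Both inequalities reduce to this: each vector admissible on the left is matched by one
    admissible on the right whose sum is stochastically at least as large. *)
Lemma rho_bar_le d (T : measurableType d) (R : realType) (P : probability T R)
  (rho : (R -> R) -> R) (n : nat) (F G : 'I_n -> R -> R) : monotone_rm rho ->
  (forall X : 'I_n -> T -> R, (forall i, measurable_fun setT (X i)) ->
    (forall i, rv_cdf P (X i) = F i) ->
    exists Y : 'I_n -> T -> R, [/\ forall i, measurable_fun setT (Y i),
      forall i, rv_cdf P (Y i) = G i &
      forall x, rv_cdf P (fun t => \sum_(i < n) Y i t) x <=
                rv_cdf P (fun t => \sum_(i < n) X i t) x]) ->
  (rho_bar P rho F <= rho_bar P rho G)%E.
Proof.
move=> hrho H; apply: ge_ereal_sup => _ [_ [X [mX XF ->]] <-].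
have [Y [mY YG YX]] := H X mX XF.
apply: (@le_trans _ _ (rho (rv_cdf P (fun t => \sum_(i < n) Y i t)))%:E).
  by rewrite lee_fin; apply: hrho => //; apply: rv_cdf_is_cdf; apply: measurable_sum.
by apply: ereal_sup_ubound; exists (rv_cdf P (fun t => \sum_(i < n) Y i t)) => //; exists Y.
Qed.

Lemma rho_bar_mix_pareto_le d (T : measurableType d) (R : realType) (P : probability T R)
  (rho : (R -> R) -> R) (n : nat) (a : R) (th : 'I_n -> R) (L : 'M[R]_n) :
  monotone_rm rho -> 0 < a <= 1 -> (forall i, 0 < th i) -> doubly_stochastic L ->
  (rho_bar P rho (mix_cdfs L (pareto_tuple a th))
     <= rho_bar P rho (pareto_tuple a (mix_vec L th)))%E.
Proof.
move=> hrho a01 th0 [L0 Lr Lc]; have /andP[a0 _] := a01.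
apply: rho_bar_le => // X mX XF.
have Z i : exists Z, [/\ measurable_fun setT Z, rv_cdf P Z = pareto a (mix_vec L th i) &
    forall t, X i t <= Z t].
  (* A positive entry of the row makes the mixed scale positive and the mixed cdf strictly less than
     [1]. *)
  have [j Lj] : exists j, 0 < L i j.
    apply/existsP; apply: contraT; rewrite negb_exists => /forallP H.
    have := Lr i; rewrite big1 => [/eqP|j _]; first by rewrite eq_sym oner_eq0.
    by apply/eqP; rewrite eq_le L0 andbT leNgt.
  apply: pareto_rearrangement => //.
  - rewrite /mix_vec (bigD1 j) //= ltr_pwDl ?mulr_gt0 // sumr_ge0 // => k _.
    by rewrite mulr_ge0 // ltW.
  - rewrite XF; apply: continuous_big => [x|k _ x]; first exact: add_continuous.
    by apply: cvgM; [exact: cvg_cst|exact: pareto_continuous].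
  - move=> y; rewrite XF pareto_mix_ge //= -(Lr i) /mix_cdfs (bigD1 j) //= [ltRHS](bigD1 j) //=.
    rewrite ltr_leD ?gtr_pMr ?pareto_lt1 // ler_sum // => k _.
    by rewrite ler_piMr // ltW // pareto_lt1.
  - exists 0; rewrite XF /mix_cdfs big1 // => k _.
    by rewrite /pareto_tuple /pareto leNgt th0 mulr0.
have [Y HY] := choice Z.
exists Y; split; try by move=> i; case: (HY i).
apply: rv_cdf_le; try by apply: measurable_sum => // i; case: (HY i).
by move=> t; apply: ler_sum => i _; case: (HY i).
Qed.

(** * The measurable space of bit streams *)

(** Latest bit first: moving to a child in the binary tree is then a [cons], and recursion along a
    branch is structural. *)
Fixpoint rprefix (b : nat -> bool) (m : nat) : seq bool :=
  if m is m'.+1 then b m' :: rprefix b m' else [::].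

Definition cylinder (s : seq bool) : set (nat -> bool) :=
  [set b | rprefix b (size s) = s].

(** The empty set is included to cover intersections of incompatible cylinders. *)
Definition cylinders : set (set (nat -> bool)) :=
  [set A | A = set0 \/ exists s, A = cylinder s].

Definition bitstream := g_sigma_algebraType cylinders.

Lemma size_rprefix b m : size (rprefix b m) = m.
Proof. by elim: m => //= m ->. Qed.

Lemma drop_rprefix b m k : drop k (rprefix b (k + m)) = rprefix b m.
Proof. by elim: k => [|k IH]; [rewrite drop0|rewrite addSn]. Qed.

(** Two cylinders are nested or disjoint, according to whether the longer prefix extends the shorter
    one. *)
Lemma cylinderI_closed : setI_closed cylinders.
Proof.
suff sub s k r : cylinders (cylinder s `&` cylinder r) \/ size r != (k + size s)%N.
  move=> A B [->|[s ->]] [->|[r ->]]; rewrite ?set0I ?setI0; try by left.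
  have [sr|/ltnW rs] := leqP (size s) (size r).
    by have [//|/eqP] := sub s (size r - size s)%N r; rewrite subnK.
  by have [|/eqP] := sub r (size s - size r)%N s; [rewrite setIC|rewrite subnK].
have [rE|] := eqVneq (size r) (k + size s)%N; last by right.
left; have [sE|sE] := eqVneq (drop k r) s.
  right; exists r; apply/seteqP; split => [b []//|b br]; split => //.
  by rewrite /cylinder /= -[RHS]sE -br rE drop_rprefix.
left; rewrite -subset0 => b [/= bs br]; move/eqP: sE; apply.
by rewrite -[RHS]bs -br rE drop_rprefix.
Qed.

Lemma measurable_cylinder s : measurable (cylinder s : set bitstream).
Proof. by apply: sub_gen_smallest; right; exists s. Qed.

Lemma measurable_bit k : measurable [set b : bitstream | b k].
Proof.
have -> : [set b : bitstream | b k] =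
    \big[setU/set0]_(s : k.-tuple bool) cylinder (true :: s).
  apply/seteqP; split => b /=.
    move=> bk; rewrite -bigcup_seq /=.
    exists (Tuple (introT eqP (size_rprefix b k))); first by rewrite /= mem_index_enum.
    by rewrite /cylinder /= size_rprefix bk.
  by rewrite -bigcup_seq => -[s _] /=; rewrite /cylinder /= => -[] ; rewrite size_tuple.
by apply: bigsetU_measurable => s _; exact: measurable_cylinder.
Qed.

Lemma preimage_cylinder_cons (T : Type) (c : T -> nat -> bool) x s :
  c @^-1` cylinder (x :: s) = c @^-1` cylinder s `&` [set t | c t (size s) = x].
Proof.
by apply/seteqP; split => t; rewrite /cylinder /= => -[]; [move=> -> ->|move=> -> ->].
Qed.

(** * Realizing a mixture of laws on an atomless space *)

(** The mixture prescribes a mass [v s] for every cylinder. Sets [D s] of these masses are nested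
    along the tree, and [b t] is the branch whose sets contain [t]. *)
Lemma realize_mixture d (T : measurableType d) (R : realType) (P : probability T R)
  (K : finType) (w : K -> R) (c : K -> T -> nat -> bool) : atomless P ->
  (forall k, 0 <= w k) -> \sum_k w k = 1 ->
  (forall k m, measurable [set t | c k t m]) ->
  exists b : T -> bitstream, forall E : set bitstream, measurable E ->
    [/\ measurable (b @^-1` E), forall k, measurable (c k @^-1` E) &
     fine (P (b @^-1` E)) = \sum_k w k * fine (P (c k @^-1` E))].
Proof.
move=> aP w0 w1 mc.
pose v s := \sum_k w k * fine (P (c k @^-1` cylinder s)).
have mccyl k s : measurable (c k @^-1` cylinder s).
  elim: s => [|x s IH].
    by rewrite (_ : _ @^-1` _ = setT) //; apply/seteqP; split.
  rewrite preimage_cylinder_cons; apply: measurableI => //.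
  case: x; first exact: mc.
  rewrite (_ : [set _ | _] = ~` [set t | c k t (size s)]); first exact/measurableC/mc.
  by apply/seteqP; split => t /=; case: (c k t _).
have v0 s : 0 <= v s by apply: sumr_ge0 => k _; rewrite mulr_ge0 // fine_ge0.
have vnil : v [::] = 1.
  rewrite -[RHS]w1; apply: eq_bigr => k _.
  rewrite (_ : _ @^-1` _ = setT) ?probability_setT ?mulr1 //.
  by apply/seteqP; split.
have vcons s : v (false :: s) = v s - v (true :: s).
  rewrite -sumrB; apply: eq_bigr => k _; rewrite -mulrBr -fine_probabilityD //; last first.
    by rewrite preimage_cylinder_cons; apply: subIsetl.
  congr (_ * fine (P _)); rewrite !preimage_cylinder_cons.
  apply/seteqP; split => t /= [ct H]; split => //; move: H; case: (c k t _) => //.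
    by move=> _ [].
  by move=> H; exfalso; apply: H.
have split_ex (Br : set T * R) : exists C, measurable Br.1 -> 0 <= Br.2 <= fine (P Br.1) ->
    [/\ measurable C, C `<=` Br.1 & fine (P C) = Br.2].
  have [[mB /andP[r0 rB]]|h] := pselect (measurable Br.1 /\ 0 <= Br.2 <= fine (P Br.1)).
    by have [C CP] := sierpinski aP mB r0 rB; exists C.
  by exists set0 => mB rB; exfalso; apply: h.
have [f fP] := choice split_ex.
(* [D s] is split in two according to the weights of the two children of the cylinder [s]. *)
pose D := fix D s : set T := if s is x :: s' then
  let C := f (D s', v (true :: s')) in if x then C else D s' `\` C else setT.
have DP s : measurable (D s) /\ fine (P (D s)) = v s.
  elim: s => [|x s [mD PD]]; first by split; rewrite ?vnil /= ?probability_setT.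
  have [||mC CD PC] := fP (D s, v (true :: s)); [exact: mD| |].
    by rewrite /= v0 PD -subr_ge0 -vcons v0.
  by case: x => /=; split; rewrite ?fine_probabilityD ?vcons ?PD ?PC //; exact: measurableD.
have fD s : f (D s, v (true :: s)) `<=` D s.
  have [||//] := fP (D s, v (true :: s)); first by case: (DP s).
  by rewrite /= v0 (DP s).2 -subr_ge0 -vcons v0.
(* [h t m] is the depth-[m] node whose set contains [t]; [b t m] tells whether [t] lies in its
   [true] child. *)
pose h := fix h (t : T) m : seq bool := if m is m'.+1 then
  `[< f (D (h t m'), v (true :: h t m')) t >] :: h t m' else [::].
pose b (t : T) m := `[< f (D (h t m), v (true :: h t m)) t >].
have hb t m : rprefix (b t) m = h t m by elim: m => //= m ->.
have bD s : b @^-1` cylinder s = D s.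
  apply/seteqP; split => t; rewrite /cylinder /= hb.
    elim: s => //= x s IH [+ hs]; rewrite hs => <-.
    by case: asboolP => // nf; split => //; exact: IH.
  elim: s => //= x s IH.
  case: x => [ft|[Dt nft]].
    by rewrite IH; [congr (_ :: _); apply/asboolP|exact: fD].
  by rewrite IH //; congr (_ :: _); apply/asboolP.
exists b => E mE; move: E mE.
(* Both sides respect complements and countable disjoint unions, so agreement on the pi-system of
   cylinders extends to all measurable sets; measurability of the preimages is carried along. *)
apply: (@dynkin_induction _ bitstream cylinders) => //.
- exact: cylinderI_closed.
- split=> [|k|]; rewrite ?preimage_setT // probability_setT -[LHS]w1.
  by apply: eq_bigr => k _; rewrite mulr1.
- move=> _ [->|[s ->]].
    split=> [|k|]; rewrite ?preimage_set0 ?measure0 ?big1 // => k _.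
    by rewrite ?preimage_set0 ?measure0 mulr0.
  by split => //; rewrite bD; case: (DP s).
- move=> E mE [mb mk bE]; split=> [|k|].
  + exact: (measurableC mb).
  + exact: (measurableC (mk k)).
  + have PC (A : set T) : measurable A -> fine (P (~` A)) = 1 - fine (P A).
      by move=> mA; rewrite -setTD fine_probabilityD // probability_setT.
    rewrite (PC _ mb) bE -[X in X - _]w1 -sumrB; apply: eq_bigr => k _.
    by rewrite (PC _ (mk k)) mulrBr mulr1.
- move=> F mF tF FP.
  have mbF i : measurable (b @^-1` F i) by case: (FP i).
  have mcF k i : measurable (c k @^-1` F i) by case: (FP i).
  have tpre (g : T -> bitstream) : trivIset setT (fun i => g @^-1` F i).
    apply/trivIsetP => i j _ _ ij; rewrite -subset0 => t gt.
    by have /trivIsetP/(_ i j I I ij) := tF; rewrite -subset0 => /(_ (g t) gt).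
  split=> [|k|]; rewrite preimage_bigcup; try exact: bigcup_measurable.
  have PU (A : (set T)^nat) : (forall i, measurable (A i)) -> trivIset setT A ->
      (fine (P (\bigcup_i A i)))%:E = (\sum_(0 <= i <oo) P (A i))%E.
    move=> mA tA; have mU : measurable (\bigcup_i A i) by exact: bigcup_measurable.
    by rewrite fine_probabilityK // measure_semi_bigcup.
  apply: EFin_inj; rewrite (PU _ mbF (tpre b)).
  under eq_eseriesr => i _.
    rewrite -fine_probabilityK //; case: (FP i) => _ _ ->; rewrite -sumEFin.
    over.
  rewrite nneseries_sum -?sumEFin; last by move=> k i _; rewrite lee_fin mulr_ge0 // fine_ge0.
  apply: eq_bigr => k _; rewrite preimage_bigcup EFinM.
  rewrite (PU _ (mcF k) (tpre (c k))).
  rewrite -nneseriesZl //.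
  by apply: eq_eseriesr => i _; rewrite EFinM fine_probabilityK.
Qed.

(** * Coding real vectors as bit streams *)

(* Bit [k] records whether [q < x i], where [k] codes the pair [(i, q)]. *)
Definition threshold_bits (R : realType) (n : nat) (x : 'I_n -> R) : nat -> bool :=
  fun k => if unpickle k is Some iq then ratr (iq : 'I_n * rat).2 < x iq.1 else false.

(* [x i] is the supremum of the rationals below it; [fine] sends infinite suprema to [0]. *)
Definition coordinate_of_bits (R : realType) (n : nat) (i : 'I_n) (b : bitstream) : R :=
  fine (esups (fun k : nat =>
    if unpickle k is Some iq then
      if ((iq : 'I_n * rat).1 == i) && b k then (ratr iq.2 : R)%:E else -oo%E
    else -oo%E) 0%N).

Lemma threshold_bitsK (R : realType) (n : nat) (x : 'I_n -> R) i :
  coordinate_of_bits R i (threshold_bits x) = x i.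
Proof.
rewrite /coordinate_of_bits; apply: EFin_inj; rewrite (_ : esups _ _ = (x i)%:E) //.
apply/eqP; rewrite eq_le; apply/andP; split.
  apply: ge_ereal_sup => _ [k _ <-]; rewrite /threshold_bits.
  case: (unpickle k) => [[j q]|] /=; last exact: leNye.
  by case: eqP => [->|_] /=; [case: ifP => [/ltW|_]; rewrite ?lee_fin ?leNye|exact: leNye].
apply/lee_subgt0Pr => e e0.
have xe : x i - e < x i by rewrite ltrBlDr ltrDl.
have [q] := rat_in_itvoo xe.
rewrite in_itv /= => /andP[eq qx].
apply: (@le_trans _ _ (ratr q : R)%:E); first by rewrite -EFinB lee_fin ltW.
apply: ereal_sup_ubound; exists (pickle (i, q)) => //=.
by rewrite /threshold_bits pickleK /= eqxx qx.
Qed.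

(** A supremum of countably many functions, each depending on at most one bit. *)
Lemma measurable_coordinate_of_bits (R : realType) (n : nat) (i : 'I_n) :
  measurable_fun setT (@coordinate_of_bits R n i).
Proof.
apply: (measurableT_comp (f := fine)) => //.
apply: measurable_fun_esups => k.
case: (unpickle k) => [[j q]|]; last exact: measurable_cst.
case: (j == i) => /=; last exact: measurable_cst.
apply: measurable_fun_ifT => //.
apply: (measurable_fun_bool true); rewrite setTI (_ : _ @^-1` _ = [set b : bitstream | b k]).
  exact: measurable_bit.
by apply/seteqP; split => b.
Qed.

(** * The first inequality *)

(** [Y] decodes the mixture of the encoded permutations of [X]. Coding whole vectors preserves joint
    laws, and the sum is invariant under permutation, so its law is the same in every component of
    the mixture. *)
Lemma rv_cdf_permuted_mixture d (T : measurableType d) (R : realType) (P : probability T R)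
  (n : nat) (w : 'S_n -> R) (X : 'I_n -> T -> R) : atomless P ->
  (forall s, 0 <= w s) -> \sum_s w s = 1 -> (forall i, measurable_fun setT (X i)) ->
  exists Y : 'I_n -> T -> R, [/\ forall i, measurable_fun setT (Y i),
    forall i x, rv_cdf P (Y i) x = \sum_s w s * rv_cdf P (X (s i)) x &
    rv_cdf P (fun t => \sum_(i < n) Y i t) = rv_cdf P (fun t => \sum_(i < n) X i t)].
Proof.
move=> aP w0 w1 mX.
pose c (s : 'S_n) (t : T) := threshold_bits (fun i => X (s i) t).
have mc s m : measurable [set t | c s t m].
  rewrite /c /threshold_bits; case: (unpickle m) => [[i q]|].
    rewrite (_ : [set _ | _] = ~` [set t | X (s i) t <= ratr q]).
      by apply: measurableC; exact: measurable_sublevel.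
    by apply/seteqP; split => t /=; rewrite ltNge => /negP.
  rewrite (_ : [set _ | _] = set0) //.
  by apply/seteqP; split.
have [b bP] := realize_mixture aP w0 w1 mc.
exists (fun i t => coordinate_of_bits R i (b t)); split.
- move=> i _ B mB; rewrite setTI.
  have mE := @measurable_coordinate_of_bits R n i measurableT B mB.
  by rewrite setTI in mE; case: (bP _ mE).
- move=> i x.
  have mE := measurable_sublevel x (@measurable_coordinate_of_bits R n i).
  have [_ _ PE] := bP _ mE.
  rewrite /rv_cdf [LHS]PE; apply: eq_bigr => s _; congr (_ * fine (P _)).
  by apply/seteqP; split => t /=; rewrite threshold_bitsK.
- apply/funext => x.
  have mS : measurable_fun setT (fun b => \sum_(i < n) @coordinate_of_bits R n i b).
    by apply: measurable_sum => i; exact: measurable_coordinate_of_bits.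
  have [_ _ PE] := bP _ (measurable_sublevel x mS).
  rewrite /rv_cdf [LHS]PE -[RHS]mul1r -w1 mulr_suml; apply: eq_bigr => s _.
  have E t : \sum_(i < n) coordinate_of_bits R i (c s t) = \sum_(i < n) X i t.
    rewrite [RHS](reindex_inj (@perm_inj _ s)).
    by apply: eq_bigr => i _; rewrite threshold_bitsK.
  by congr (_ * fine (P _)); apply/seteqP; split => t /=; rewrite E.
Qed.

Lemma rho_bar_le_mix_cdfs d (T : measurableType d) (R : realType) (P : probability T R)
  (rho : (R -> R) -> R) (n : nat) (F : 'I_n -> R -> R) (L : 'M[R]_n) :
  atomless P -> monotone_rm rho -> doubly_stochastic L ->
  (rho_bar P rho F <= rho_bar P rho (mix_cdfs L F))%E.
Proof.
move=> aP hrho [L0 Lr Lc]; apply: rho_bar_le => // X mX XF.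
(* For [n = 0] there are no marginals to match, and Birkhoff's theorem is stated for positive
   size. *)
have [n0|n0] := posnP n; first by exists X; split => // i; have := ltn_ord i; rewrite {2}n0.
have [w [w0 w1 Lw]] := birkhoff L0 Lr Lc n0.
have [Y [mY YL YX]] := rv_cdf_permuted_mixture aP w0 w1 mX.
exists Y; split => // [i|x]; last by rewrite YX.
apply/funext => x; rewrite YL /mix_cdfs; under [RHS]eq_bigr do rewrite Lw mulr_suml.
(* After exchanging the sums, each permutation [s] contributes only through column [s i]. *)
rewrite exchange_big; apply: eq_bigr => s _; rewrite XF (bigD1 (s i)) //= eqxx mulr1.
by rewrite big1 ?addr0 // => j; rewrite eq_sym => /negbTE ->; rewrite mulr0 mul0r.
Qed.

Theorem theorem15 (d : measure_display) (T : measurableType d) (R : realType)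
  (P : probability T R) (hP : atomless P)
  (rho : (R -> R) -> R) (hrho : monotone_rm rho)
  (n : nat) (alpha : R) (theta : 'I_n -> R) (L : 'M[R]_n) :
  0 < alpha <= 1 ->
  (forall i, 0 < theta i) ->
  doubly_stochastic L ->
  (rho_bar P rho (pareto_tuple alpha theta)
     <= rho_bar P rho (mix_cdfs L (pareto_tuple alpha theta)))%E /\
  (rho_bar P rho (mix_cdfs L (pareto_tuple alpha theta))
     <= rho_bar P rho (pareto_tuple alpha (mix_vec L theta)))%E.
Proof.
by move=> a01 th0 ds; split; [exact: rho_bar_le_mix_cdfs|exact: rho_bar_mix_pareto_le].
Qed.
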